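(* Let $G$ be a finite nilpotent group of class $2$, and let $K$ be a subgroup of $G$ with $G'\le K\le Z(G)$. Let $\Gamma=G(\omega;K)$, let $g_0,\dots,g_{|G|-1}$ be any enumeration of $G$ with $g_0=1$, and let $\{v_i: i<\omega\}$ be the corresponding standard enumeration of $\Gamma$. Then the ordering $v_0<v_1<v_2<\cdots$ of $\Gamma$ is an AZ-enumeration of $\Gamma$ with respect to $\Omega$.
   Context: Central product: $G^\omega$ denotes the restricted direct product of $\omega$ copies of $G$ (sequences $(g_i)_{i<\omega}$ in $G$ with $g_i=1$ for all but finitely many $i$), similarly $K^\omega$; $(K^\omega)^0=\{(k_i)\in K^\omega:\prod_i k_i=1\}$, and $\Gamma=G(\omega;K)=G^\omega/(K^\omega)^0$. Likewise $\Gamma_n=G(n;K)=G^n/(K^n)^0$, with $(K^n)^0=\{(k_0,\dots,k_{n-1})\in K^n:\prod_i k_i=1\}$, identified with the image in $\Gamma$ of the first $n$ coordinates. Standard enumeration: order $G$ by $g_0<g_1<\cdots<g_{|G|-1}$ and order $G^\omega$ reverse lexicographically: $(a_i)<(b_i)$ if there is $j$ with $a_j<b_j$ and $a_i=b_i$ for all $i>j$. Define $v_n$ inductively: $v_n$ is the coset of $(K^\omega)^0$ having the representative that is minimal in $G^\omega$ among all sequences not representing any of $v_0,\dots,v_{n-1}$. The group $\Omega\le \mathrm{Aut}(\Gamma)$: (1) For a finitary permutation $\sigma$ of $\omega$, let $\hat\sigma\in\mathrm{Aut}(\Gamma)$ be induced by $(g_0,g_1,\dots)\mapsto(g_{\sigma(0)},g_{\sigma(1)},\dots)$.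 (2) Let $m$ be the exponent of $G$ and $M=m+2$. For $0\le i<M$ let $\alpha_i(g)\in G^M$ be the tuple with $i$-th entry $1$ and all other entries $g$. The map $(g_0,\dots,g_{M-1})\mapsto \alpha_0(g_0)\alpha_1(g_1)\cdots\alpha_{M-1}(g_{M-1})$, followed by the quotient map to $\Gamma_M$, induces an automorphism $\beta^*$ of $\Gamma_M$ of order dividing $2$ fixing $K$ pointwise (known, Apps); extend $\beta^*$ to $\Gamma$ by letting it act trivially on coordinates with index $\ge M$. (3) For $i_0,j_0\in\omega$ and a finite $I\subset\omega$ with $\{i_0,j_0\}\cap I=\emptyset$ and $m$ dividing $|I|$, let $\alpha_{I,i_0,j_0}\in\mathrm{Aut}(\Gamma)$ be an automorphism, chosen as a composition of automorphisms of the form $\hat\sigma$ and $\beta^*$, such that whenever $(g_i)\in G^\omega$ has $g_i=1$ for $i\in I\cup\{j_0\}$ and $g_{i_0}\ne1$, the class of $(g_i)$ is sent to the class of $(g_i')$, where $g'_i=g_i$ for $i\notin I$ and $g'_i=g_{i_0}$ for $i\in I$. (Such automorphisms exist.) $\Omega$ is the subgroup of $\mathrm{Aut}(\Gamma)$ generated by all $\hat\sigma$ and all $\alpha_{I,i_0,j_0}$. AZ-enumeration with respect to a subgroup: let $M$ be a countable structure and $\mathcal{H}\le\mathrm{Aut}(M)$. The closure of $\mathcal{H}$ is taken in the space $M^M$ of all functions $M\to M$ (topology of pointwise convergence, $M$ discrete). An ordering $<$ of $M$ of type $\omega$ is an AZ-enumeration with respect to $\mathcal{H}$ if for any $n$ and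 any sequence $\bar a_i$, $i\in\omega$, of $n$-tuples from $M$ there are $i\ne j$ and an order preserving map ($x<y$ implies its images satisfy the same) in the closure of $\mathcal{H}$ which maps $\bar a_i$ to $\bar a_j$. *)

(* Defs.v *)
From HB Require Import structures.
From mathcomp Require Import all_boot all_fingroup all_solvable finmap.
From mathcomp Require Import boolp classical_sets topology function_spaces.

Set Implicit Arguments.
Unset Strict Implicit.
Unset Printing Implicit Defensive.

Local Open Scope quotient_scope.
Local Open Scope group_scope.

(* The finite group [G] is the whole type [gT], and [rpower gT] is
   [G^omega]. *)
Definition rpower (gT : finGroupType) : Type := {fsfun nat -> gT with 1}.

HB.instance Definition _ (gT : finGroupType) := Choice.on (rpower gT).

Coercion rpower_fsfun (gT : finGroupType) (a : rpower gT) :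
  {fsfun nat -> gT with 1} := a.

Section RestrictedPower.
Variable gT : finGroupType.
Implicit Types a b c : rpower gT.

Lemma rpowerP a b : (forall i, a i = b i) -> a = b.
Proof. by move=> eq_ab; apply/fsfunP. Qed.

Definition rpower_one : rpower gT := [fsfun with 1].

Definition rpower_inv a : rpower gT := [fsfun i in finsupp a => (a i)^-1].

Definition rpower_mul a b : rpower gT :=
  [fsfun i in (finsupp a `|` finsupp b)%fset => a i * b i].

Lemma rpower_oneE i : rpower_one i = 1.
Proof. by rewrite /rpower_fsfun fsfun0E. Qed.

Lemma rpower_invE a i : rpower_inv a i = (a i)^-1.
Proof.
rewrite /rpower_fsfun fsfunE; case: ifPn => // /fsfun_dflt ai.
by rewrite [X in X^-1]ai invg1.
Qed.

Lemma rpower_mulE a b i : rpower_mul a b i = a i * b i.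
Proof.
rewrite /rpower_fsfun fsfunE in_fsetU; case: ifPn => //.
by rewrite negb_or => /andP[/fsfun_dflt -> /fsfun_dflt ->]; rewrite mulg1.
Qed.

Fact rpower_mulA : associative rpower_mul.
Proof. by move=> a b c; apply: rpowerP => i; rewrite !rpower_mulE mulgA. Qed.

Fact rpower_mul1g : left_id rpower_one rpower_mul.
Proof.
by move=> a; apply: rpowerP => i; rewrite rpower_mulE rpower_oneE mul1g.
Qed.

Fact rpower_mulg1 : right_id rpower_one rpower_mul.
Proof.
by move=> a; apply: rpowerP => i; rewrite rpower_mulE rpower_oneE mulg1.
Qed.

Fact rpower_mulVg : left_inverse rpower_one rpower_inv rpower_mul.
Proof.
move=> a; apply: rpowerP => i.
by rewrite rpower_mulE rpower_invE rpower_oneE mulVg.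
Qed.

Fact rpower_mulgV : right_inverse rpower_one rpower_inv rpower_mul.
Proof.
move=> a; apply: rpowerP => i.
by rewrite rpower_mulE rpower_invE rpower_oneE mulgV.
Qed.

End RestrictedPower.

HB.instance Definition _ (gT : finGroupType) :=
  isGroup.Build (rpower gT) (@rpower_mulA gT) (@rpower_mul1g gT)
    (@rpower_mulg1 gT) (@rpower_mulVg gT) (@rpower_mulgV gT).

Section RestrictedPowerTheory.
Variable gT : finGroupType.
Implicit Types a b c : rpower gT.

Lemma rp1E i : (1 : rpower gT) i = 1. Proof. exact: rpower_oneE. Qed.

Lemma rpVE a i : a^-1 i = (a i)^-1. Proof. exact: rpower_invE. Qed.

Lemma rpME a b i : (a * b) i = a i * b i. Proof. exact: rpower_mulE. Qed.

Definition rplength a : nat := \max_(i <- finsupp a) i.+1.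

Definition rptotal a : gT := \prod_(i < rplength a) a i.

Lemma rplengthP a i : rplength a <= i -> a i = 1.
Proof.
move=> le_ai; apply: fsfun_dflt; apply: contraTN le_ai => ai.
by rewrite -ltnNge /rplength (big_rem i) //= leq_max leqnn.
Qed.

Lemma rptotalE n a : (forall i, n <= i -> a i = 1) ->
  rptotal a = \prod_(i < n) a i.
Proof.
have ext m1 m2 : m1 <= m2 -> (forall i, m1 <= i -> a i = 1) ->
    \prod_(i < m2) a i = \prod_(i < m1) a i.
  move=> le_m12 a1; rewrite -!(big_mkord xpredT (fun i => a i)).
  rewrite (big_cat_nat (leq0n _) le_m12) /= [X in _ * X]big_nat_cond.
  by rewrite [X in _ * X]big1 ?mulg1 // => i /andP[/andP[/a1]].
move=> a1; have [le_na|/ltnW le_an] := leqP n (rplength a); first exact: ext.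
by rewrite /rptotal -(ext _ _ le_an) // => i /rplengthP.
Qed.

End RestrictedPowerTheory.

Section KernelDef.
Variables (gT : finGroupType) (K : {group gT}).

(* [(K^omega)^0]; as [K] is central, the order of the factors in [rptotal] is
   irrelevant on it. *)
Definition Kpower0 : {pred rpower gT} :=
  [pred a : rpower gT | all (fun i => a i \in K) (finsupp a)
                        && (rptotal a == 1)].

Definition cpower_rel : rel (rpower gT) := fun a b => a^-1 * b \in Kpower0.

End KernelDef.

Section CentralProduct.
Variables (gT : finGroupType) (K : {group gT}).
Hypothesis cK : K \subset 'Z([set: gT]).
Implicit Types a b c : rpower gT.

Lemma Kpower0P a :
  reflect ((forall i, a i \in K) /\ rptotal a = 1) (a \in Kpower0 K).
Proof.
apply: (iffP andP) => [[/allP aK /eqP ->]|[aK ->]].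
  split=> // i; have [/aK //|/fsfun_dflt ai] := boolP (i \in finsupp a).
  by rewrite /rpower_fsfun ai group1.
by rewrite eqxx; split=> //; apply/allP => i _; apply: aK.
Qed.

Lemma cKP x y : x \in K -> x * y = y * x.
Proof. by move=> /(fintype.subsetP cK) /centerP[_]; apply; rewrite inE. Qed.

Lemma Kpower0_1 : 1 \in Kpower0 K.
Proof.
apply/Kpower0P; split=> [i|]; first by rewrite rp1E group1.
by rewrite (@rptotalE _ 0) ?big_ord0 // => i _; rewrite rp1E.
Qed.

Lemma rptotalM a b : (forall i, b i \in K) ->
  rptotal (a * b) = rptotal a * rptotal b.
Proof.
move=> bK; pose n := maxn (rplength a) (rplength b).
have an i : n <= i -> a i = 1.
  by rewrite geq_max => /andP[/rplengthP].
have bn i : n <= i -> b i = 1.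
  by rewrite geq_max => /andP[_ /rplengthP].
rewrite (rptotalE an) (rptotalE bn) (@rptotalE _ n); last first.
  by move=> i le_ni; rewrite rpME an // bn // mulg1.
rewrite -!(big_mkord xpredT (fun i => _ i)) /=.
elim: n {an bn} => [|n IHn]; first by rewrite !big_geq // mulg1.
rewrite !big_nat_recr //= IHn rpME -!mulgA; congr (_ * _); rewrite !mulgA.
congr (_ * _); rewrite cKP //.
apply: (big_ind (fun x => x \in K)) => [|x y xK yK|i _]; last exact: bK.
  exact: group1.
exact: groupM.
Qed.

Lemma Kpower0M a b : a \in Kpower0 K -> b \in Kpower0 K -> a * b \in Kpower0 K.
Proof.
move=> /Kpower0P[aK a1] /Kpower0P[bK b1]; apply/Kpower0P; split=> [i|].
  by rewrite rpME groupM.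
by rewrite rptotalM // a1 b1 mulg1.
Qed.

Lemma Kpower0V a : a \in Kpower0 K -> a^-1 \in Kpower0 K.
Proof.
move=> /Kpower0P[aK a1]; apply/Kpower0P; split=> [i|].
  by rewrite rpVE groupV.
have := rptotalM a^-1 aK; rewrite mulVg a1 mulg1 => <-.
by case/Kpower0P: Kpower0_1.
Qed.

Lemma Kpower0C a b : a \in Kpower0 K -> a * b = b * a.
Proof. by case/Kpower0P => aK _; apply: rpowerP => i; rewrite !rpME cKP. Qed.

Fact cpower_rel_refl : reflexive (cpower_rel K).
Proof. by move=> a; rewrite /cpower_rel mulVg Kpower0_1. Qed.

Fact cpower_rel_sym : symmetric (cpower_rel K).
Proof.
suff sub a b : cpower_rel K a b -> cpower_rel K b a.
  by move=> a b; apply/idP/idP; apply: sub.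
by move=> /Kpower0V; rewrite invgM invgK.
Qed.

Fact cpower_rel_trans : transitive (cpower_rel K).
Proof.
by move=> b a c ab bc; move: (Kpower0M ab bc); rewrite mulgA mulgK.
Qed.

Canonical cpower_equiv :=
  EquivRel (cpower_rel K) cpower_rel_refl cpower_rel_sym cpower_rel_trans.

End CentralProduct.

(* [Gamma = G(omega; K)], the quotient of [G^omega] by [(K^omega)^0]. *)
Definition cpower (gT : finGroupType) (K : {group gT})
  (cK : K \subset 'Z([set: gT])) : Type := {eq_quot cpower_equiv cK}.

HB.instance Definition _ (gT : finGroupType) (K : {group gT})
  (cK : K \subset 'Z([set: gT])) := Choice.on (cpower cK).
HB.instance Definition _ (gT : finGroupType) (K : {group gT})
  (cK : K \subset 'Z([set: gT])) := EqQuotient.on (cpower cK).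

Section CentralProductGroup.
Variables (gT : finGroupType) (K : {group gT}).
Hypothesis cK : K \subset 'Z([set: gT]).
Local Notation Gamma := (cpower cK).
Local Notation qrepr := (generic_quotient.repr).
Implicit Types (a b c : rpower gT) (x y z : Gamma).

Definition cclass a : Gamma := \pi_Gamma a.

Lemma cclassP a b : reflect (cclass a = cclass b) (cpower_rel K a b).
Proof. exact: (@eqquotP _ (cpower_equiv cK)). Qed.

Lemma cclass_surj x : exists a, x = cclass a.
Proof. by exists (qrepr x); rewrite /cclass reprK. Qed.

Definition cpower_one : Gamma := cclass 1.
Definition cpower_inv x : Gamma := cclass (qrepr x)^-1.
Definition cpower_mul x y : Gamma := cclass (qrepr x * qrepr y).

Lemma repr_cclass a : cpower_rel K a (qrepr (cclass a)).
Proof. by apply/cclassP; rewrite /cclass reprK. Qed.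

Lemma cpower_mulE a b : cpower_mul (cclass a) (cclass b) = cclass (a * b).
Proof.
apply/esym/cclassP; have := repr_cclass a; have := repr_cclass b.
move: (qrepr _) (qrepr _) => b' a' bb' aa'.
rewrite /cpower_rel invgM -mulgA (mulgA a^-1) (Kpower0C cK _ aa').
by rewrite mulgA (Kpower0M cK).
Qed.

Lemma cpower_invE a : cpower_inv (cclass a) = cclass a^-1.
Proof.
apply/esym/cclassP; have := repr_cclass a; move: (qrepr _) => a'.
rewrite /cpower_rel invgK => aa'.
have k : a'^-1 * a \in Kpower0 K by rewrite -[_ \in _](cpower_rel_sym cK).
suff -> : a * a'^-1 = a'^-1 * a by [].
by rewrite -{1}(mulKVg a' a) -(Kpower0C cK a' k) mulgK.
Qed.

Fact cpower_mulA : associative cpower_mul.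
Proof.
move=> x y z; have [[a ->] [b ->] [c ->]] :=
  And3 (cclass_surj x) (cclass_surj y) (cclass_surj z).
by rewrite !cpower_mulE mulgA.
Qed.

Fact cpower_mul1g : left_id cpower_one cpower_mul.
Proof. by move=> x; have [a ->] := cclass_surj x; rewrite cpower_mulE mul1g. Qed.

Fact cpower_mulg1 : right_id cpower_one cpower_mul.
Proof. by move=> x; have [a ->] := cclass_surj x; rewrite cpower_mulE mulg1. Qed.

Fact cpower_mulVg : left_inverse cpower_one cpower_inv cpower_mul.
Proof.
move=> x; have [a ->] := cclass_surj x.
by rewrite cpower_invE cpower_mulE mulVg.
Qed.

Fact cpower_mulgV : right_inverse cpower_one cpower_inv cpower_mul.
Proof.
move=> x; have [a ->] := cclass_surj x.
by rewrite cpower_invE cpower_mulE mulgV.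
Qed.

End CentralProductGroup.

HB.instance Definition _ (gT : finGroupType) (K : {group gT})
  (cK : K \subset 'Z([set: gT])) :=
  isGroup.Build (cpower cK) (@cpower_mulA _ _ cK) (@cpower_mul1g _ _ cK)
    (@cpower_mulg1 _ _ cK) (@cpower_mulVg _ _ cK) (@cpower_mulgV _ _ cK).

Section StandardEnumeration.
Variable gT : finGroupType.

(* The sequence [s] lists the elements [g_0, g_1, ...] of [G]; it is not
   required to start with [1]. *)
Definition group_enumeration (s : seq gT) : Prop := perm_eq s (enum gT).

Definition enum_order (s : seq gT) (x y : gT) : bool := index x s < index y s.

Definition revlex (s : seq gT) (a b : rpower gT) : Prop :=
  exists j, enum_order s (a j) (b j) /\ forall i, j < i -> a i = b i.

(* These conditions determine [v].  When [s] starts with [1], every sequence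
   has finitely many predecessors for [revlex s], so that [v] exists as soon as
   [Gamma] is infinite. *)
Definition standard_enumeration (K : {group gT})
    (cK : K \subset 'Z([set: gT])) (s : seq gT) (v : nat -> cpower cK) : Prop :=
  forall n, exists a : rpower gT,
    [/\ v n = cclass cK a,
        forall m, m < n -> cclass cK a <> v m
      & forall b : rpower gT, (forall m, m < n -> cclass cK b <> v m) ->
          b = a \/ revlex s a b].

End StandardEnumeration.

Section Automorphisms.
Variable G : groupType.
Local Open Scope classical_set_scope.

Definition automorphisms : set (G -> G) :=
  [set f | bijective f /\ {morph f : x y / x * y}].

Definition automorphism_subgroup (H : set (G -> G)) : Prop :=
  [/\ H `<=` automorphisms, H id,
      forall f g, H f -> H g -> H (f \o g)
    & forall f g, H f -> cancel f g -> cancel g f -> H g].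

Definition generated_automorphisms (S : set (G -> G)) : set (G -> G) :=
  smallest automorphism_subgroup S.

Lemma automorphism_subgroupT : automorphism_subgroup automorphisms.
Proof.
split=> //.
- by split=> //; exists id.
- move=> f g [bij_f fM] [bij_g gM]; split; first exact: bij_comp.
  by move=> x y /=; rewrite gM fM.
- move=> f g [_ fM] fK gK; split; first by exists f.
  by move=> x y; apply: (can_inj fK); rewrite fM !gK.
Qed.

End Automorphisms.

Section SequenceMaps.
Variable gT : finGroupType.
Implicit Types (a : rpower gT) (I : {fset nat}).

(* A finitary permutation of omega is a bijective [sigma], where
   [{fsfun nat -> nat}] is the type of the functions from nat to nat that fix
   all but finitely many points. *)
Definition shuffle (sigma : {fsfun nat -> nat}) a : rpower gT :=
  [fsfun i in (finsupp a `|` finsupp sigma)%fset => a (sigma i)].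

Lemma shuffleE sigma a i : shuffle sigma a i = a (sigma i).
Proof.
rewrite /rpower_fsfun fsfunE in_fsetU; case: ifPn => //.
by rewrite negb_or => /andP[/fsfun_dflt ai /fsfun_dflt ->].
Qed.

(* The tuple [alpha_i(g)] of [G^M], extended by 1s. *)
Definition all_but (M i : nat) (g : gT) : rpower gT :=
  [fsfun k in seq_fset tt (iota 0 M) => if k == i then 1 else g].

Definition drop_coords (M : nat) a : rpower gT :=
  [fsfun k in finsupp a => if k < M then 1 else a k].

(* On the first [M] coordinates this is the map inducing [beta^*]; it leaves
   the coordinates of index at least [M] unchanged. *)
Definition beta_seq (M : nat) a : rpower gT :=
  (\prod_(i < M) all_but M i (a i)) * drop_coords M a.

Definition spread I (i0 : nat) a : rpower gT :=
  [fsfun k in (finsupp a `|` I)%fset => if k \in I then a i0 else a k].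

Lemma all_butE M i g k :
  all_but M i g k = if (k < M) && (k != i) then g else 1.
Proof.
rewrite /rpower_fsfun fsfunE seq_fsetE mem_iota add0n leq0n /=.
by case: (k < M) => //=; case: eqP.
Qed.

Lemma drop_coordsE M a k : drop_coords M a k = if k < M then 1 else a k.
Proof.
rewrite /rpower_fsfun fsfunE; case: ifPn => // /fsfun_dflt ak.
by case: ifP => // _; rewrite ak.
Qed.

Lemma spreadE I i0 a k : spread I i0 a k = if k \in I then a i0 else a k.
Proof.
rewrite /rpower_fsfun fsfunE in_fsetU; case: ifPn => //.
by rewrite negb_or => /andP[/fsfun_dflt -> /negPf ->].
Qed.

End SequenceMaps.

Section Omega.
Variables (gT : finGroupType) (K : {group gT}).
Hypothesis cK : K \subset 'Z([set: gT]).
Local Notation Gamma := (cpower cK).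
Local Notation m := (exponent [set: gT]).
Local Open Scope classical_set_scope.

(* The automorphisms of [Gamma] induced by [F] on representatives; there is at
   most one. *)
Definition induced_automorphisms (F : rpower gT -> rpower gT) :
    set (Gamma -> Gamma) :=
  [set f | automorphisms f /\
           forall a : rpower gT, f (cclass cK a) = cclass cK (F a)].

Definition shuffle_automorphisms : set (Gamma -> Gamma) :=
  [set f | exists sigma : {fsfun nat -> nat},
     bijective sigma /\ induced_automorphisms (shuffle sigma) f].

Definition beta_automorphisms : set (Gamma -> Gamma) :=
  induced_automorphisms (beta_seq m.+2).

Definition alpha_index (I : {fset nat}) (i0 j0 : nat) : Prop :=
  [/\ i0 \notin I, j0 \notin I & m %| #|` I|].

(* [alpha] is one of the possible choices of the automorphisms
   [alpha_{I, i0, j0}].  The compositions of the automorphisms [sigma^] and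
   [beta^*] form the subgroup they generate, since their inverses are of the
   same form. *)
Definition alpha_choice (alpha : {fset nat} -> nat -> nat -> Gamma -> Gamma) :
    Prop :=
  forall (I : {fset nat}) (i0 j0 : nat), alpha_index I i0 j0 ->
    generated_automorphisms (shuffle_automorphisms `|` beta_automorphisms)
      (alpha I i0 j0) /\
    forall a : rpower gT,
      (forall i, i \in I -> a i = 1) -> a j0 = 1 -> a i0 <> 1 ->
      alpha I i0 j0 (cclass cK a) = cclass cK (spread I i0 a).

Definition Omega (alpha : {fset nat} -> nat -> nat -> Gamma -> Gamma) :
    set (Gamma -> Gamma) :=
  generated_automorphisms
    (shuffle_automorphisms `|`
     [set f | exists I i0 j0, alpha_index I i0 j0 /\ f = alpha I i0 j0]).

Lemma Omega_automorphisms alpha :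
  alpha_choice alpha -> Omega alpha `<=` @automorphisms Gamma.
Proof.
move=> alphaP f; apply; split; first exact: automorphism_subgroupT.
move=> g [[sigma [_ []]] //|[I [i0 [j0 [/alphaP[+ _] ->]]]]].
apply; split; first exact: automorphism_subgroupT.
by move=> h [[sigma [_ []]]|[]].
Qed.

End Omega.

Section AZ.
Variable M : choiceType.
Local Open Scope classical_set_scope.

Definition order_type_omega (lt : M -> M -> Prop) : Prop :=
  exists v : nat -> M, bijective v /\ forall i j, lt (v i) (v j) <-> i < j.

Definition pointwise_closure (H : set (M -> M)) : set (M -> M) :=
  closure (H : set {ptws M -> discrete_topology M}).

(* The structure on [M] enters only through the group [H] of automorphisms. *)
Definition AZ_enumeration (H : set (M -> M)) (lt : M -> M -> Prop) : Prop :=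
  order_type_omega lt /\
  forall (n : nat) (a : nat -> n.-tuple M),
    exists i j, i <> j /\
      exists f : M -> M,
        [/\ pointwise_closure H f, forall x y, lt x y -> lt (f x) (f y)
          & map_tuple f (a i) = a j].

Definition enum_lt (v : nat -> M) (x y : M) : Prop :=
  exists i j, [/\ x = v i, y = v j & i < j].

End AZ.

(* Main.v *)
Require Import Defs.
From HB Require Import structures.
From mathcomp Require Import all_boot all_fingroup all_solvable finmap.
From mathcomp Require Import boolp classical_sets topology function_spaces.

Set Implicit Arguments.
Unset Strict Implicit.
Unset Printing Implicit Defensive.

(* The minimal representative of a class is its normal form: every entry except
   the one of index 0 is minimal in its coset of K, and v enumerates the normal
   forms in reverse lexicographic order.  Let phi : nat -> nat be a surjection
   with fibres of cardinality 1 modulo the exponent m, such that the maxima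
   e(c) of the fibres increase with c and the fibre of 0 is {0}.  Then
   a |-> a o phi preserves normal forms and their order, and on sequences of
   bounded support it agrees with an element of Omega: a finitary permutation
   moves the coordinate c to e(c), and then alpha automorphisms copy it to the
   rest of the fibre of c.  So the induced map of Gamma lies in the closure of
   Omega.

   To find such a phi between two n-tuples of a given sequence, read a tuple of
   normal forms as a word over G^n and mark in it the position 0 and the last
   occurrence of every letter.  By Higman's lemma two of the marked words, with
   the same marked letters and the same numbers of occurrences modulo m, embed
   into each other as subsequences; every letter skipped by the embedding e then
   reoccurs further right at a position e(c), and phi sends it to c. *)

(** * Words over a finite alphabet: pigeonhole principle and Higman's lemma *)

Lemma infinite_fiber (T : finType) (h : nat -> T) :
  exists a, exists2 g : nat -> nat,
    {homo g : i j / i < j} & forall k, h (g k) = a.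
Proof.
have [a /choice[pick pickP]] : exists a, forall N, exists i, N <= i /\ h i = a.
  apply: contrapT => /forallNP H.
  have /choice[B BP] a : exists N, forall i, N <= i -> h i <> a.
    have /existsNP[N /forallNP HN] := H a.
    by exists N => i le_Ni hi; apply: (HN i).
  (* The index [\max_a B a] reaches the bound of every value, including the value that [h] takes
     there. *)
  by apply: (BP (h (\max_a B a)) _ _ erefl); apply: leq_bigmax.
exists a; exists (fun k => iter k (fun i => pick i.+1) (pick 0)).
  apply: homo_ltn ltn_trans _ => k /=.
  by have [] := pickP (iter k (fun i => pick i.+1) (pick 0)).+1.
by case=> [|k] /=; apply: (pickP _).2.
Qed.

(** Nash-Williams' minimal bad sequence argument: [next p] is a shortest word by which the prefix
    [p] still extends to a bad sequence, and [z] is the bad sequence of these choices. *)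
Lemma higman (T : finType) (x : nat -> seq T) :
  exists i j, i < j /\ subseq (x i) (x j).
Proof.
pose bad (y : nat -> seq T) := forall i j, i < j -> ~~ subseq (y i) (y j).
pose bad_prefix p := exists2 y, bad y & forall k, k < size p -> y k = nth [::] p k.
apply: contrapT => good_x.
have bad_x : bad x.
  by move=> i j lt_ij; apply/negP => s_ij; apply: good_x; exists i, j.
have /choice[next nextP] p : exists w, bad_prefix p -> bad_prefix (rcons p w) /\
    forall w', bad_prefix (rcons p w') -> size w <= size w'.
  have [[y bad_y yp]|//] := pselect (bad_prefix p); last by exists [::].
  pose sz n := `[< exists2 w, bad_prefix (rcons p w) & size w = n >].
  have ex_sz : exists n, sz n.
    exists (size (y (size p))); apply/asboolP; exists (y (size p)) => //.
    exists y => // k; rewrite size_rcons nth_rcons ltnS leq_eqVlt.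
    by case: ltngtP => // [/yp|->].
  case: (ex_minnP ex_sz) => n /asboolP[w bad_w <-] min_w; exists w => _.
  by split=> // w' bad_w'; apply: min_w; apply/asboolP; exists w'.
pose p k := iter k (fun p => rcons p (next p)) [::].
pose z k := next (p k).
have pE k : p k = mkseq z k by elim: k => //= k IHk; rewrite mkseqS /z /p -IHk.
have bad_p k : bad_prefix (p k).
  by elim: k => [|k IHk]; [exists x | exact: (nextP _ IHk).1].
have bad_z : bad z.
  move=> i j lt_ij; have [y bad_y] := bad_p j.+1.
  rewrite pE size_mkseq => yz; rewrite -(nth_mkseq [::] z (ltnW lt_ij : i < j.+1)).
  by rewrite -(nth_mkseq [::] z (ltnSn j)) -!yz ?bad_y // ltnW.
have z0 k : z k != [::].
  by apply: contraNneq (bad_z k k.+1 (ltnSn k)) => ->; apply: sub0seq.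
have [a [g g_mono ga]] := infinite_fiber (fun k => ohead (z k)).
(* Infinitely many words of [z] begin with the same letter. Deleting it from them, and keeping the
   words of [z] before the first of them, leaves a bad sequence whose word at [g 0] is shorter than
   [z (g 0)], against minimality. *)
pose y k := if k < g 0 then z k else behead (z (g (k - g 0))).
have g0 k : g 0 <= g k by case: k => // k; apply: ltnW; apply: g_mono.
have bad_y : bad y.
  move=> i j lt_ij; rewrite /y; case: ltnP => [lt_i0|le_0i].
    case: ltnP => [_|le_0j]; first exact: bad_z.
    have := bad_z i (g (j - g 0)) (leq_trans lt_i0 (g0 _)).
    by apply: contra => /subseq_trans; apply; rewrite -drop1 drop_subseq.
  rewrite ltnNge (leq_trans le_0i (ltnW lt_ij)) /=.
  have lt_g : g (i - g 0) < g (j - g 0).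
    by apply: g_mono; rewrite ltn_sub2r // (leq_ltn_trans le_0i).
  apply: contra (bad_z _ _ lt_g).
  move: (ga (i - g 0)) (ga (j - g 0)) (z0 (g (i - g 0))).
  by case: (z _) => // b u; case: (z _) => [<- //|c w /= <- [->]]; rewrite eqxx.
have [|_ /(_ (y (g 0)))] := nextP (p (g 0)) _; first exact: bad_p.
rewrite /y ltnn subnn size_behead -/(z _) => contra0.
suff: size (z (g 0)) <= (size (z (g 0))).-1.
  by have := z0 (g 0); rewrite -size_eq0; case: (size _) => // n _; rewrite ltnn.
apply: contra0; exists y => // k.
rewrite size_rcons nth_rcons pE size_mkseq ltnS leq_eqVlt /y.
case: ltngtP => // [lt_k _|-> _]; last by rewrite subnn.
by rewrite nth_mkseq.
Qed.

(** * Embeddings of words, and the maps [phi] obtained from them *)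

(** Past the end of [s1] the embedding continues as a shift, so that [e] is total, increasing, and
    takes every value from [size s2] on. *)
Lemma subseq_embedding (T : eqType) (t0 : T) (s1 s2 : seq T) :
  subseq s1 s2 -> exists e : nat -> nat,
    [/\ {homo e : i j / i < j},
        forall c, c < size s1 -> e c < size s2 /\ nth t0 s2 (e c) = nth t0 s1 c
      & forall c, e (size s1 + c) = size s2 + c].
Proof.
elim: s2 s1 => [|x s2 IHs] [|y s1] //=; first by exists id; split.
  by exists (addn (size s2).+1); split=> // i j; rewrite ltn_add2l.
case: eqP => [-> /IHs|_ /IHs] [e [e_mono es e_tail]].
  exists (fun c => if c is c'.+1 then (e c').+1 else 0); split.
  - by case=> [|i] [|j] //=; rewrite !ltnS => /e_mono.
  - by case=> [|c] //=; rewrite !ltnS => /es.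
  - by move=> c /=; rewrite e_tail.
exists (fun c => (e c).+1); split=> [i j /e_mono|c /es|c] //=.
by rewrite e_tail.
Qed.

(** The positions of [s2] in the image of [e] reproduce [s1]; the second summand counts the letters
    that [e] skips. *)
Lemma count_embedding (T : eqType) (t0 : T) (s1 s2 : seq T) (e : nat -> nat)
    (P : pred T) :
  injective e ->
  (forall c, c < size s1 -> e c < size s2 /\ nth t0 s2 (e c) = nth t0 s1 c) ->
  count P s2 = count P s1 +
    count [pred k | P (nth t0 s2 k) & k \notin map e (iota 0 (size s1))]
          (iota 0 (size s2)).
Proof.
move=> e_inj es; set im := map e _.
rewrite -{1}(mkseq_nth t0 s2) /mkseq count_map.
rewrite -(seq.permP (permEl (perm_filterC (mem im) _))) count_cat; congr (_ + _).
  rewrite -{1}(mkseq_nth t0 s1) /mkseq count_map.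
  have /seq.permP -> : perm_eq [seq k <- iota 0 (size s2) | mem im k] im.
    apply: uniq_perm; rewrite ?filter_uniq ?map_inj_uniq ?iota_uniq // => k.
    rewrite mem_filter mem_iota /=; case: (boolP (k \in im)) => // /mapP[c].
    by rewrite mem_iota /= => /es[lt_c _] ->.
  rewrite count_map; apply: eq_in_count => c; rewrite mem_iota /= => /es[_ ->] //.
by rewrite count_filter; apply: eq_count => k /=.
Qed.

(* [e c] is the largest element of the fibre of [phi] at [c]. *)
Record thickening (m : nat) (phi e : nat -> nat) (D : nat) : Prop :=
  Thickening {
    thick_eK : cancel e phi;
    thick_mono : {homo e : i j / i < j};
    thick_le : forall k, k <= e (phi k);
    thick_phi0 : forall k, phi k = 0 -> k = 0;
    thick_tail : forall k, D <= k -> e (phi k) = k;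
    thick_dvd : forall c,
      m %| count (fun k => (phi k == c) && (k != e c)) (iota 0 D)
  }.

(** Higman's lemma embeds the marked word [i] into the marked word [j] by some [e]; [phi] inverts
    [e] on its image and sends a skipped position to the last occurrence of its letter in word
    [i]. *)
Lemma thickening_wqo (T : finType) (t0 : T) (col : nat -> nat -> T) (m : nat) :
  0 < m -> (forall i, exists L, forall k, L <= k -> col i k = t0) ->
  exists i j, i <> j /\ exists phi e D,
    thickening m phi e D /\ forall k, col j k = col i (phi k).
Proof.
move=> m_gt0 col_tail.
(* [N i] is positive so that position 0 belongs to the word and gets its mark. *)
have {col_tail} /choice[N NP] i :
    exists N, 0 < N /\ forall k, N <= k -> col i k = t0.
  by have [L LP] := col_tail i; exists L.+1; split=> // k /ltnW/LP.
have N_gt0 i : 0 < N i by case: (NP i).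
have col_tail i : forall k, N i <= k -> col i k = t0 by case: (NP i).
pose later i k k' := (k < k') && (col i k' == col i k).
(* The first mark says that the letter does not reoccur before [N i], the second that the position
   is 0. *)
pose tag i k := (col i k, ~~ has (later i k) (iota 0 (N i)), k == 0).
pose w i := mkseq (tag i) (N i).
pose color i : {ffun T * bool * bool -> bool * 'I_m.+1} :=
  [ffun t => (t \in w i, inord (count_mem t (w i) %% m))].
have [col0 [g g_mono g_col]] := infinite_fiber color.
have [i' [j' [lt_ij]]] := higman (w \o g); rewrite /comp.
have : color (g i') = color (g j') by rewrite !g_col.
move: (g_mono _ _ lt_ij); move: (g i') (g j') => i j {}lt_ij eq_col sub_ij.
exists i, j; split; first by move=> eq_ij; rewrite eq_ij ltnn in lt_ij.
have size_w k : size (w k) = N k by rewrite size_mkseq.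
have [e [e_mono e_w e_tail]] := subseq_embedding (t0, true, true) sub_ij.
have e_inj : injective e.
  by move=> x y exy; case: (ltngtP x y) => // /e_mono; rewrite exy ltnn.
have e_tag c : c < N i -> e c < N j /\ tag j (e c) = tag i c.
  move=> lt_c; have := e_w c; rewrite !size_w => /(_ lt_c)[lt_ec].
  by rewrite !nth_mkseq.
have e0 : e 0 = 0.
  by have [_ [_ _]] := e_tag 0 (N_gt0 i); case: (e 0).
have last_uniq l k1 k2 b1 b2 a : k1 < N l -> k2 < N l ->
    tag l k1 = (a, true, b1) -> tag l k2 = (a, true, b2) -> k1 = k2.
  wlog le_12 : k1 k2 b1 b2 / k1 <= k2.
    by move=> W *; have [/W|/ltnW/W] := leqP k1 k2; [|move=> W'; apply/esym]; eauto.
  move=> _ lt2 [a1 /hasPn no_later _] [a2 _ _].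
  apply/eqP; rewrite eqn_leq le_12 leqNgt; apply/negP => lt_12.
  have := no_later k2; rewrite mem_iota /= => /(_ lt2).
  by rewrite /later lt_12 a1 a2 eqxx.
have mem_w l k : k < N l -> tag l k \in w l.
  by move=> lt_k; apply/mapP; exists k => //; rewrite mem_iota.
have [eq_supp eq_cnt] : w i =i w j /\
    forall t, count_mem t (w i) = count_mem t (w j) %[mod m].
  split=> t; have := congr1 (fun f : {ffun _} => f t) eq_col.
    by rewrite !ffunE => -[].
  rewrite !ffunE => -[].
  move=> _ /(congr1 val); rewrite /= !inordK // ltnS ltnW // ltn_mod //.
pose im := map e (iota 0 (N i)).
pose copy k c := [/\ k < N j, k \notin im, k <= e c, c < N i
                  & tag i c = (col j k, true, false)].
pose rel k c := k = e c \/ copy k c.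
have /choice[phi phiP] : forall k, exists c, rel k c.
  move=> k; have [le_k|lt_k] := leqP (N j) k.
    exists (N i + (k - N j)); left.
    by have := e_tail (k - N j); rewrite !size_w => ->; rewrite subnKC.
  have [/mapP[c _ ->]|k_im] := boolP (k \in im); first by exists c; left.
  have k_gt0 : 0 < k.
    rewrite lt0n; apply: contraNneq k_im => ->.
    by apply/mapP; exists 0; rewrite ?mem_iota ?e0 //= add0n.
  (* The largest such [q] is the last occurrence in word [j] of the letter at [k]. Its marked letter
     also occurs in word [i], at some [c]; last occurrences being unique, [e c = q], hence
     [k <= e c]. *)
  pose Q q := (q < N j) && (col j q == col j k).
  have exQ : exists q, Q q by exists k; rewrite /Q lt_k eqxx.
  have maxQ q : Q q -> q <= N j by case/andP => /ltnW.
  case: (ex_maxnP exQ maxQ) => q /andP[lt_q /eqP col_q] q_max.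
  have le_kq : k <= q by apply: q_max; rewrite /Q lt_k eqxx.
  have tag_q : tag j q = (col j k, true, false).
    congr (_, _, _) => //; last by apply/negbTE; rewrite -lt0n (leq_trans k_gt0).
    apply/hasPn => k'; rewrite mem_iota /= => lt_k'.
    apply/negP => /andP[]; rewrite ltnNge => /negP lt_qk' /eqP col_k'.
    by apply/lt_qk'/q_max; rewrite /Q lt_k' col_k' col_q eqxx.
  have := mem_w _ _ lt_q; rewrite tag_q -eq_supp => /mapP[c].
  rewrite mem_iota /= add0n => lt_c tag_c; exists c; right; split=> //.
  have [lt_ec tag_ec] := e_tag c lt_c.
  by rewrite (last_uniq _ _ _ _ _ _ lt_ec lt_q (etrans tag_ec (esym tag_c)) tag_q).
(* From [N i] on the values of [e] are at least [N j], so a skipped position below [N j] is no value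
   of [e] at all. *)
have inserted k : k < N j -> k \notin im -> forall c, k <> e c.
  move=> lt_k k_im c def_k; have [le_c|lt_c] := leqP (N i) c.
    have := e_tail (c - N i); rewrite !size_w subnKC // -def_k => eq_k.
    by move: lt_k; rewrite eq_k ltnNge leq_addr.
  by case/mapP: k_im; exists c => //; rewrite mem_iota.
have eK : cancel e phi.
  move=> c; case: (phiP (e c)) => [/e_inj//|[lt_ec im_ec _ _ _]].
  by case: (inserted _ lt_ec im_ec c).
exists phi, e, (N j); split; last first.
  move=> k; case: (phiP k) => [def_k|[_ _ _ _ [->]]] //.
  have [le_p|lt_p] := leqP (N i) (phi k).
    rewrite (col_tail i) // col_tail // def_k -(subnKC le_p).
    by have := e_tail (phi k - N i); rewrite !size_w => ->; rewrite leq_addr.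
  by have [_ [<- _ _]] := e_tag _ lt_p; rewrite -def_k.
split=> // [k|k|k|c].
- by case: (phiP k) => [<-|[]].
- by case: (phiP k) => [def_k phik|[_ _ _ _ [_ _ /eqP]] //]; rewrite def_k phik.
- by case: (phiP k) => [<-|[lt_k _ _ _ _]] //; rewrite leqNgt lt_k.
have phi_ins k : phi k != c \/ k = e c \/ copy k c.
  by have [<-|] := eqVneq (phi k) c; [right; exact: phiP | left].
(* Unless [c] is a last occurrence other than position 0, its fibre is [e c] alone. *)
have [[a [lt_c tag_c]]|no_a] :=
    pselect (exists a, c < N i /\ tag i c = (a, true, false)); last first.
  rewrite (_ : count _ _ = 0) //; apply/eqP; rewrite -leqn0 leqNgt -has_count.
  apply/hasPn => k _; apply/negP => /andP[phik kc].
  case: (phi_ins k) => [|[|[_ _ _ lt_c tag_c]]]; rewrite ?phik //.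
    exact/eqP.
  by apply: no_a; exists (col j k).
(* The fibre of [c] without [e c] consists of the skipped positions marked as [t]: they have the
   letter [a], a later occurrence at [e c], and are not 0. Their number is the excess of [t] in word
   [j], a multiple of [m]. *)
pose t := (a, false, false).
suff -> : count (fun k => (phi k == c) && (k != e c)) (iota 0 (N j)) =
    count [pred k | pred1 t (nth (t0, true, true) (w j) k)
                  & k \notin map e (iota 0 (size (w i)))]
          (iota 0 (size (w j))).
  have cnt := count_embedding (pred1 t) e_inj e_w.
  by have /esym/eqP := eq_cnt t; rewrite cnt eqn_mod_dvd ?leq_addr // addKn.
rewrite !size_w; apply: eq_in_count => k; rewrite mem_iota /= add0n => lt_k.
rewrite nth_mkseq //; have [lt_ec tag_ec] := e_tag c lt_c.
apply/idP/idP.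
  case/andP=> phik kc.
  case: (phi_ins k) => [|[|[_ k_im le_kc _]]]; rewrite ?phik //.
    by move/eqP; rewrite (negbTE kc).
  rewrite tag_c => -[col_k]; rewrite k_im andbT.
  have -> : tag j k = (col j k, ~~ true, false); last by rewrite -col_k eqxx.
  rewrite /tag; congr (_, ~~ _, _).
    apply/hasP; exists (e c); first by rewrite mem_iota.
    rewrite /later ltn_neqAle kc le_kc -col_k.
    by move: tag_ec; rewrite tag_c => -[->]; rewrite eqxx.
  apply/eqP => k0; move/mapP: k_im; apply; exists 0; last by rewrite k0 e0.
  by rewrite mem_iota /= add0n.
case/andP=> /eqP tag_k k_im.
have [def_k|[_ _ _ lt_p]] := phiP k; first by case: (inserted _ lt_k k_im (phi k)).
case: tag_k => -> _ _ tag_p.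
rewrite (last_uniq _ _ _ _ _ _ lt_p lt_c tag_p tag_c) eqxx /=.
by apply/eqP; apply: inserted.
Qed.

(** * Finitary permutations and the automorphisms that they induce *)

Local Open Scope group_scope.

Lemma fsfun_extend (h : nat -> nat) (B : nat) :
  (forall k, B <= k -> h k = k) -> exists sigma : {fsfun nat -> nat}, sigma =1 h.
Proof.
move=> hB; exists [fsfun k in seq_fset tt (iota 0 B) => h k] => k.
rewrite fsfunE seq_fsetE mem_iota /= add0n; case: ltnP => // /hB //.
Qed.

Lemma finitary_perm_extending (e : nat -> nat) (N : nat) : injective e ->
  exists sigma : {fsfun nat -> nat},
    bijective sigma /\ forall c, c < N -> sigma (e c) = c.
Proof.
move=> e_inj; suff [h [bij_h [B hB] he]] : exists h : nat -> nat,
    [/\ bijective h, exists B, forall k, B <= k -> h k = k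
      & forall c, c < N -> h (e c) = c].
  have [sigma sE] := fsfun_extend hB; exists sigma.
  split=> [|c /he]; last by rewrite sE.
  by apply: (eq_bij bij_h) => k; rewrite sE.
elim: N => [|N [h [bij_h [B hB] he]]].
  by exists id; split=> //; [exists id | exists 0].
(* The transposition of [h (e N)] and [N] corrects the value at [e N]; it fixes every [c < N], since
   [c = h (e c)] differs from [h (e N)]. *)
pose sw k := if k == h (e N) then N else if k == N then h (e N) else k.
have swK : involutive sw.
  move=> k; rewrite /sw; case: (eqVneq k (h (e N))) => [->|kx].
    by rewrite eqxx; case: eqVneq.
  case: (eqVneq k N) => [->|kN]; first by rewrite eqxx.
  by rewrite (negbTE kx) (negbTE kN).
exists (sw \o h); split.
- by apply: bij_comp => //; exists sw.
- exists (maxn B (maxn N (h (e N))).+1) => k.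
  rewrite !geq_max => /andP[/hB /= -> ]; rewrite gtn_max /sw => /andP[lt1 lt2].
  by rewrite !gtn_eqF.
- move=> c /=; rewrite ltnS leq_eqVlt => /predU1P[->|lt_c]; first by rewrite /sw eqxx.
  rewrite /sw he // (ltn_eqF lt_c); case: eqVneq => // def_c.
  have cN := e_inj c N (bij_inj bij_h (etrans (he _ lt_c) def_c)).
  by rewrite cN ltnn in lt_c.
Qed.

Lemma finitary_perm_inverse (sigma : {fsfun nat -> nat}) : bijective sigma ->
  exists tau : {fsfun nat -> nat}, cancel sigma tau /\ cancel tau sigma.
Proof.
case=> g sK gK; pose tau : {fsfun nat -> nat} := [fsfun k in finsupp sigma => g k].
suff tE k : tau k = g k by exists tau; split=> k; rewrite tE.
rewrite fsfunE; case: ifPn => // /fsfun_dflt sk; by rewrite -{2}sk sK.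
Qed.

Section Shuffle.
Variables (gT : finGroupType) (K : {group gT}).
Hypothesis cK : K \subset 'Z([set: gT]).
Implicit Types (a b : rpower gT) (sigma : {fsfun nat -> nat}).

(** The factors are central, so exchanging adjacent blocks keeps the product, and such exchanges
    generate all permutations. Membership in [K] is carried along in the induction. *)
Lemma perm_prod_central (s t : seq gT) :
  perm_eq s t -> all (mem K) s -> \prod_(x <- s) x = \prod_(x <- t) x.
Proof.
move=> st sK; suff: all (mem K) t && (\prod_(x <- s) x == \prod_(x <- t) x).
  by case/andP => _ /eqP.
pose P t : Prop := all (mem K) t && (\prod_(x <- s) x == \prod_(x <- t) x).
apply: (catCA_perm_ind (P := P) _ st); last by rewrite /P sK eqxx.
move=> s1 s2 s3; rewrite /P !all_cat !big_cat /= => /andP[/and3P[K1 -> ->] /eqP ->].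
have p1K : \prod_(x <- s1) x \in K.
  by rewrite big_seq; apply: group_prod => x; apply: (allP K1).
by rewrite K1 /= !mulgA (cKP cK _ p1K).
Qed.

Lemma rptotal_shuffle sigma a : bijective sigma -> (forall i, a i \in K) ->
  rptotal (shuffle sigma a) = rptotal a.
Proof.
move=> bij_s aK; have s_inj := bij_inj bij_s.
(* [B] bounds the supports of [a] and [sigma], so [sigma] permutes the indices below [B]. *)
pose B := maxn (rplength a) (\max_(i <- finsupp sigma) i.+1).
have lt_supp k : k \in finsupp sigma -> k < B.
  by move=> ks; rewrite /B leq_max (big_rem k) //= leq_max leqnn orbT.
have sB k : B <= k -> sigma k = k.
  by move=> le_k; apply: fsfun_dflt; apply: contraTN le_k => /lt_supp; rewrite -ltnNge.
have aB k : B <= k -> a k = 1.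
  by rewrite geq_max => /andP[/rplengthP].
rewrite (rptotalE aB) (@rptotalE _ B); last by move=> k le_k; rewrite shuffleE sB ?aB.
rewrite -!(big_mkord xpredT (fun i => _ i)) /index_iota subn0.
rewrite -(big_map (shuffle sigma a) xpredT id) -[RHS](big_map a xpredT id).
apply: perm_prod_central; last first.
  by apply/allP => x /mapP[k _ ->]; rewrite shuffleE; apply: aK.
rewrite (eq_map (shuffleE sigma a)) (map_comp a sigma); apply: perm_map.
apply: uniq_perm; rewrite ?map_inj_uniq ?iota_uniq //.
have uniq_s : uniq (map sigma (iota 0 B)) by rewrite map_inj_uniq ?iota_uniq.
have sub_s : {subset map sigma (iota 0 B) <= iota 0 B}.
  move=> k /mapP[i]; rewrite !mem_iota /= add0n => lt_i ->.
  rewrite ltnNge; apply/negP => /[dup] /sB /s_inj ->.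
  by rewrite leqNgt lt_i.
by have [|_] := uniq_min_size uniq_s sub_s; rewrite ?size_map.
Qed.

Lemma shuffleM sigma : {morph @shuffle gT sigma : a b / a * b}.
Proof. by move=> a b; apply: rpowerP => i; rewrite !(rpME, shuffleE). Qed.

Lemma shuffleV sigma a : shuffle sigma a^-1 = (shuffle sigma a)^-1.
Proof. by apply: rpowerP => i; rewrite !(rpVE, shuffleE). Qed.

Lemma shuffle_Kpower0 sigma a : bijective sigma ->
  a \in Kpower0 K -> shuffle sigma a \in Kpower0 K.
Proof.
move=> bij_s /(Kpower0P) [aK a1]; apply/Kpower0P; split=> [i|].
  by rewrite shuffleE.
by rewrite rptotal_shuffle.
Qed.

Lemma cclassM a b : cclass cK (a * b) = cclass cK a * cclass cK b.
Proof. exact/esym/cpower_mulE. Qed.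

Lemma shuffle_automorphism sigma : bijective sigma ->
  exists f, induced_automorphisms (cK := cK) (shuffle sigma) f.
Proof.
pose F sigma (x : cpower cK) := cclass cK (shuffle sigma (generic_quotient.repr x)).
have FE (rho : {fsfun nat -> nat}) a : bijective rho ->
    F rho (cclass cK a) = cclass cK (shuffle rho a).
  move=> bij_rho; apply/esym/cclassP; rewrite /cpower_rel -shuffleV -shuffleM.
  exact/shuffle_Kpower0/repr_cclass.
move=> bij_s; have [tau [sK tK]] := finitary_perm_inverse bij_s.
have bij_t : bijective tau by exists sigma.
exists (F sigma); split; last by move=> a; apply: FE.
split.
  by exists (F tau) => x; have [a ->] := cclass_surj x; rewrite !FE //;
    congr cclass; apply: rpowerP => i; rewrite !shuffleE ?sK ?tK.
move=> x y; have [[a ->] [b ->]] := (cclass_surj x, cclass_surj y).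
by rewrite -cclassM !FE // shuffleM cclassM.
Qed.

End Shuffle.

(** * Pullback along [phi] as a limit of elements of [Omega] *)

(** Eventual agreement at each point is convergence in a product of discrete spaces. *)
Lemma pointwise_closure_seq (M : choiceType) (H : set (M -> M)) (f : M -> M)
    (h : nat -> M -> M) :
  (forall n, H (h n)) ->
  (forall x, exists N, forall n, N <= n -> h n x = f x) ->
  pointwise_closure H f.
Proof.
move=> Hh hf U Uf.
pose T := {ptws M -> discrete_topology M}.
have cvg_h : ((h : nat -> T) @ \oo --> (f : T))%classic.
  apply/cvg_sup => x V /= [W [[X oX <-] Xf] WV].
  have [N NP] := hf x; exists N => // n /= le_Nn; apply: WV => /=.
  by rewrite /= NP.
have [N _ NP] := cvg_h U Uf.
by exists (h N); split; [exact: Hh | apply: NP => /=].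
Qed.

Section Pullback.
Variables (gT : finGroupType) (m : nat) (phi e : nat -> nat) (D : nat).
Hypothesis phiP : thickening m phi e D.
Implicit Types a : rpower gT.

Lemma thick_leq_mono : {mono e : i j / i <= j}.
Proof. by apply: leq_mono; apply: thick_mono phiP. Qed.

(** The bound on the support suffices: for [k >= e (rplength a)], [e (phi k) >= k] forces
    [phi k >= rplength a]. *)
Definition pullback a : rpower gT :=
  [fsfun k in seq_fset tt (iota 0 (e (rplength a))) => a (phi k)].

Lemma pullbackE a k : pullback a k = a (phi k).
Proof.
rewrite /rpower_fsfun fsfunE seq_fsetE mem_iota /= add0n.
case: ltnP => // le_k; rewrite -[RHS]/(rpower_fsfun a (phi k)) rplengthP //.
by rewrite -thick_leq_mono (leq_trans le_k) // (thick_le phiP).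
Qed.

End Pullback.

Section Approximation.
Variables (gT : finGroupType) (K : {group gT}).
Hypothesis cK : K \subset 'Z([set: gT]).
Variable alpha : {fset nat} -> nat -> nat -> cpower cK -> cpower cK.
Hypothesis alphaP : alpha_choice alpha.
Implicit Types (a b : rpower gT) (sigma : {fsfun nat -> nat}).

Lemma Omega_comp f g : Omega alpha f -> Omega alpha g -> Omega alpha (f \o g).
Proof.
move=> Of Og H [subH genH]; have [_ _ compH _] := subH.
by apply: compH; [apply: Of | apply: Og].
Qed.

Lemma Omega_shuffle sigma : bijective sigma ->
  exists2 h, Omega alpha h & forall a, h (cclass cK a) = cclass cK (shuffle sigma a).
Proof.
move=> bij_s; have [h [autoh hE]] := shuffle_automorphism cK bij_s.
by exists h => // H [_ genH]; apply: genH; left; exists sigma.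
Qed.

Lemma Omega_alpha I i0 j0 : alpha_index gT I i0 j0 -> Omega alpha (alpha I i0 j0).
Proof. by move=> idx H [_ genH]; apply: genH; right; exists I, i0, j0. Qed.

(* [alpha_choice] says nothing when [a i0 = 1]; write [a] as a product of two
   sequences to which it applies. *)
Lemma alpha_spread (g : gT) I i0 j0 a : g != 1 -> alpha_index gT I i0 j0 -> i0 != j0 ->
  (forall i, i \in I -> a i = 1) -> a j0 = 1 ->
  alpha I i0 j0 (cclass cK a) = cclass cK (spread I i0 a).
Proof.
move=> g1 idx ij0 aI aj0; have [i0I _ _] := idx.
have [_ alphaE] := alphaP idx.
have [ai0|/eqP ai0] := eqVneq (a i0) 1; last exact: alphaE.
pose x : rpower gT := [fsfun k in [fset i0]%fset => g].
have xE k : x k = if k == i0 then g else 1 by rewrite /rpower_fsfun fsfunE in_fset1.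
have spreadM b c : spread I i0 (b * c) = spread I i0 b * spread I i0 c.
  by apply: rpowerP => k; rewrite !(rpME, spreadE); case: ifP.
have [_ alphaM] := Omega_automorphisms alphaP (Omega_alpha idx).
have xI i : i \in I -> x i = 1.
  by move=> iI; rewrite xE; case: eqP => // ii0; rewrite -ii0 iI in i0I.
have xj0 : x j0 = 1 by rewrite xE eq_sym (negbTE ij0).
have alphax : alpha I i0 j0 (cclass cK x) = cclass cK (spread I i0 x).
  by apply: alphaE => //; rewrite xE eqxx; apply/eqP.
apply: (mulIg (cclass cK (spread I i0 x))).
rewrite -{1}alphax -alphaM -!cclassM -spreadM; apply: alphaE.
- by move=> i iI; rewrite rpME aI ?xI ?mulg1.
- by rewrite rpME aj0 xj0 mulg1.
- by rewrite rpME ai0 mul1g xE eqxx; apply/eqP.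
Qed.

Section Thickening.
Variables (phi e : nat -> nat) (D : nat).
Hypothesis phiP : thickening (exponent [set: gT]) phi e D.

(** By induction on the number of filled fibres: [approx c h] says that [h] has carried the entries
    to the maxima of their fibres and has copied them throughout the fibres of indices below [c]. *)
Lemma Omega_pullback (g : gT) N : g != 1 -> exists2 h, Omega alpha h &
  forall a, (forall k, N <= k -> a k = 1) ->
    h (cclass cK a) = cclass cK (pullback phi e a).
Proof.
move=> g1.
pose approx c h := forall a, (forall k, N <= k -> a k = 1) ->
  exists2 b, h (cclass cK a) = cclass cK b &
    forall k, b k = if (k == e (phi k)) || (phi k < c) then a (phi k) else 1.
suff [h Oh hE] : exists2 h, Omega alpha h & approx N h.
  exists h => // a aN; have [b -> bE] := hE a aN; congr cclass; apply: rpowerP => k.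
  rewrite bE (pullbackE phiP); case: ifP => //; case: ltnP; first by rewrite orbT.
  by move=> /aN.
have e_inj : injective e := can_inj (thick_eK phiP).
(* The spare coordinate for all the [alpha]: being at least [D] it lies in no [I], and [phi j0 >= N]
   makes the entry there trivial. *)
pose j0 := maxn (e N) D.
have [e_j0 phi_j0] : e (phi j0) = j0 /\ N <= phi j0.
  have ej : e (phi j0) = j0 by rewrite (thick_tail phiP) // leq_maxr.
  by split; rewrite // -(thick_leq_mono phiP) ej leq_maxl.
suff: forall c, c <= N -> exists2 h, Omega alpha h & approx c h by exact.
elim=> [_|c IHc lt_cN].
  (* No fibre is filled yet; since [sigma] takes [e c] back to [c] for [c < N], shuffling by it
     moves entry [c] to [e c]. *)
  have [sigma [bij_s sE]] := finitary_perm_extending N e_inj.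
  have [h Oh hE] := Omega_shuffle bij_s; exists h => // a aN.
  exists (shuffle sigma a) => // k; rewrite shuffleE orbF.
  have [lt_s|le_s] := ltnP (sigma k) N.
    have /(bij_inj bij_s) def_k := sE _ lt_s.
    by rewrite -def_k (thick_eK phiP) eqxx sE.
  rewrite aN //; case: eqP => // def_k.
  have [lt_p|/aN //] := ltnP (phi k) N.
  by move: le_s; rewrite {1}def_k sE // leqNgt lt_p.
have [h Oh hE] := IHc (ltnW lt_cN).
(* [I] is the fibre of [c] without its maximum; it lies below [D], as later positions are maxima of
   their fibres. *)
pose P k := (phi k == c) && (k != e c).
pose I := seq_fset tt (seq.filter P (iota 0 D)).
have inI k : (k \in I) = (k < D) && P k.
  by rewrite seq_fsetE mem_filter mem_iota /= add0n andbC.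
have PI k : P k -> k \in I.
  move=> Pk; rewrite inI Pk andbT ltnNge; apply/negP => /(thick_tail phiP).
  by case/andP: Pk => /eqP-> /negP nk ek; apply: nk; rewrite ek.
have idx : alpha_index gT I (e c) j0.
  split; rewrite ?inI /P ?eqxx ?andbF //.
    by rewrite ltnNge leq_maxr.
  rewrite size_seq_fset undup_id ?filter_uniq ?iota_uniq // size_filter.
  exact: (thick_dvd phiP).
exists (alpha I (e c) j0 \o h); first exact: Omega_comp (Omega_alpha idx) Oh.
move=> a aN; have [b hb bE] := hE a aN; exists (spread I (e c) b); last first.
  move=> k; rewrite spreadE !bE; case: ifPn => [|kI].
    rewrite inI => /and3P[_ /eqP phik kc].
    by rewrite (thick_eK phiP) eqxx /= phik ltnSn orbT.
  case: eqP => //= /eqP ke; rewrite [in RHS]ltnS [in RHS]leq_eqVlt.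
  case: eqP => //= phik.
  case/negP: kI; apply: PI; rewrite /P phik eqxx /=.
  by rewrite -phik.
rewrite /= hb; apply: alpha_spread g1 idx _ _ _.
- rewrite -e_j0; apply: contraTneq lt_cN => /e_inj ->.
  by rewrite -leqNgt.
- move=> i; rewrite inI => /and3P[_ /eqP phii ic]; rewrite bE phii ltnn orbF.
  by rewrite (negbTE ic).
- by rewrite bE e_j0 eqxx /= aN.
Qed.

Lemma pullback_closure (g : gT) (f : cpower cK -> cpower cK) : g != 1 ->
  (forall x, exists2 a, x = cclass cK a & f x = cclass cK (pullback phi e a)) ->
  pointwise_closure (Omega alpha) f.
Proof.
move=> g1 fP.
have /choice[h hP] N : exists h, Omega alpha h /\
    forall a, (forall k, N <= k -> a k = 1) ->
      h (cclass cK a) = cclass cK (pullback phi e a).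
  by have [h] := Omega_pullback N g1; exists h.
apply: (pointwise_closure_seq (h := h)) => [n|x]; first by case: (hP n).
have [a -> ->] := fP x; exists (rplength a) => n le_n.
by have [_ ->] := hP n => // k le_k; apply: rplengthP; apply: leq_trans le_n le_k.
Qed.

End Thickening.
End Approximation.

(** * Normal forms of classes and their order *)

Section NormalForms.
Variables (gT : finGroupType) (s : seq gT).
Hypothesis sP : group_enumeration s.
Implicit Types a b : rpower gT.

Lemma enum_order_total x y : x != y -> ~~ enum_order s y x -> enum_order s x y.
Proof.
move=> xy; rewrite /enum_order -leqNgt leq_eqVlt => /predU1P[eq_xy|//].
have mem_s z : z \in s by rewrite (perm_mem sP) mem_enum.
by case/eqP: xy; rewrite -(nth_index 1 (mem_s x)) eq_xy nth_index.
Qed.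

Lemma top_difference a b : a <> b ->
  exists j, a j != b j /\ forall i, j < i -> a i = b i.
Proof.
move=> ab; pose P j := a j != b j.
have exP : exists j, P j.
  apply: contrapT => /forallNP noP; apply: ab; apply: rpowerP => j.
  by apply/eqP/negPn/negP/noP.
have maxP j : P j -> j <= maxn (rplength a) (rplength b).
  apply: contraTT; rewrite -ltnNge gtn_max.
  case/andP=> /ltnW/rplengthP aj /ltnW/rplengthP bj.
  by rewrite /P negbK; apply/eqP; apply: etrans aj (esym bj).
case: (ex_maxnP exP maxP) => j Pj j_max; exists j; split=> // i.
by rewrite ltnNge => /negP le_ij; apply/eqP/negPn/negP => /j_max.
Qed.

Lemma revlex_asym a b : revlex s a b -> ~ revlex s b a.
Proof.
move=> [i [ab_i eq_i]] [j [ba_j eq_j]]; case: (ltngtP i j) => [/eq_i|/eq_j|ij].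
- by move=> e; move: ba_j; rewrite /enum_order e ltnn.
- by move=> e; move: ab_i; rewrite /enum_order e ltnn.
by move: ba_j; rewrite -ij /enum_order ltnNge (ltnW ab_i).
Qed.

Section Cosets.
Variable K : {group gT}.
Hypothesis cK : K \subset 'Z([set: gT]).

(** Index 0 is exempt: it absorbs the factors from [K] by which the other entries are made
    minimal. *)
Definition normal_form a :=
  forall i k, 0 < i -> k \in K -> ~~ enum_order s (a i * k) (a i).

(** At the top difference, if its index is positive, [b] has another element of the same coset of
    [K], hence a larger one. A top difference at 0 is impossible: [c] would be concentrated there,
    with total 1. *)
Lemma normal_form_min a b : normal_form a -> cclass cK b = cclass cK a ->
  b = a \/ revlex s a b.
Proof.
move=> norm_a /esym/cclassP; rewrite /cpower_rel; set c := a^-1 * b.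
have bE i : b i = a i * c i by rewrite rpME rpVE mulKVg.
case/Kpower0P=> c_K c1; have [->|/eqP/top_difference] := eqVneq b a; first by left.
case=> j [ab_j eq_j]; right; exists j; split=> [|i /eq_j //].
case: j => [|j] in ab_j eq_j *; last first.
  by apply: enum_order_total; rewrite 1?eq_sym // bE norm_a.
case/eqP: ab_j; rewrite bE; move: c1; rewrite (@rptotalE _ 1).
  by rewrite big_ord_recl big_ord0 mulg1 /= => ->; rewrite mulg1.
by move=> i /eq_j; rewrite bE => /(canRL (mulKg _)) ->; rewrite mulVg.
Qed.

(** If [k] lowered the entry at [i.+1], multiplying by [k] there and by [k^-1] at 0 would give a
    smaller representative of the same class. *)
Lemma min_normal_form a :
  (forall b, cclass cK b = cclass cK a -> b = a \/ revlex s a b) -> normal_form a.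
Proof.
move=> min_a [//|i] k _ kK; apply/negP => lt_ak.
pose c : rpower gT := [fsfun x in [fset 0; i.+1]%fset => if x == 0 then k^-1 else k].
have cE x : c x = if x == 0 then k^-1 else if x == i.+1 then k else 1.
  by rewrite /rpower_fsfun fsfunE !inE; case: eqP => //=; case: eqP.
have c_K : c \in Kpower0 K.
  apply/Kpower0P; split=> [x|].
    by rewrite cE; do 2?case: ifP => _; rewrite ?groupV ?group1.
  rewrite (@rptotalE _ i.+2) => [|x lt_ix].
    rewrite big_ord_recl big_ord_recr big1 => [|x _].
      by rewrite /= mul1g !cE /= /bump /= add1n eqxx mulVg.
    by rewrite cE /= /bump /= !add1n eqSS ltn_eqF.
  by rewrite cE !gtn_eqF // (leq_trans _ lt_ix).
have ca : cclass cK (a * c) = cclass cK a.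
  by apply/esym/cclassP; rewrite /cpower_rel mulKg.
case: (min_a _ ca) => [/(congr1 (fun b : rpower gT => b i.+1))|].
  rewrite rpME cE /= eqxx => e; move: lt_ak.
  by rewrite e /enum_order ltnn.
apply: revlex_asym; exists i.+1; split; first by rewrite rpME cE /= eqxx.
by move=> j lt_ij; rewrite rpME cE !gtn_eqF ?mulg1 // (leq_trans _ lt_ij).
Qed.

Lemma normal_form_inj a b : normal_form a -> normal_form b ->
  cclass cK a = cclass cK b -> a = b.
Proof.
move=> norm_a norm_b eq_ab; have [//|ba] := normal_form_min norm_b eq_ab.
by have [//|/revlex_asym] := normal_form_min norm_a (esym eq_ab).
Qed.

End Cosets.

Section Pullback.
Variables (m : nat) (phi e : nat -> nat) (D : nat).
Hypothesis phiP : thickening m phi e D.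

Lemma normal_form_pullback (K : {group gT}) a :
  normal_form K a -> normal_form K (pullback phi e a).
Proof.
move=> norm_a i k i_gt0 kK; rewrite (pullbackE phiP); apply: norm_a => //.
by rewrite lt0n; apply: contraTneq i_gt0 => /(thick_phi0 phiP) ->.
Qed.

(** A top difference at [j] becomes one at [e j], the largest position of the fibre of [j]. *)
Lemma revlex_pullback a b :
  revlex s a b -> revlex s (pullback phi e a) (pullback phi e b).
Proof.
case=> j [lt_j eq_j]; exists (e j); rewrite !(pullbackE phiP) (thick_eK phiP).
split=> // k lt_k; rewrite !(pullbackE phiP) eq_j //.
rewrite ltnNge -(thick_leq_mono phiP) -ltnNge.
exact: leq_trans lt_k (thick_le phiP k).
Qed.

End Pullback.
End NormalForms.

(** * From the standard enumeration to the AZ property *)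

Theorem theorem2p4 (gT : finGroupType) (K : {group gT})
    (nilG : nilpotent [set: gT]) (classG : nil_class [set: gT] = 2)
    (derK : [set: gT]^`(1) \subset K) (cK : K \subset 'Z([set: gT]))
    (alpha : {fset nat} -> nat -> nat -> cpower cK -> cpower cK)
    (alphaP : alpha_choice alpha)
    (s : seq gT) (sP : group_enumeration s) (s0 : ohead s = Some 1)
    (v : nat -> cpower cK) (vP : standard_enumeration s v) :
  AZ_enumeration (Omega alpha) (enum_lt v).
Proof.
have /choice[a aP] := vP.
have vE n : v n = cclass cK (a n) by case: (aP n).
have v_neq i j : i < j -> v i <> v j.
  by case: (aP j) => -> fresh _ /fresh /nesym.
have v_inj : injective v.
  by move=> i j eq_ij; case: (ltngtP i j) => // /v_neq; rewrite eq_ij.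
(* Whether a sequence is still available at stage [n] depends only on its class, so [a n] is minimal
   in its own class. *)
have norm_a n : normal_form s K (a n).
  apply: (min_normal_form (cK := cK)) => b eq_b.
  by case: (aP n) => _ fresh; apply=> i; rewrite eq_b; apply: fresh.
have a_mono i j : i < j -> revlex s (a i) (a j).
  move=> lt_ij; have [_ _ min_i] := aP i; have [|eq_a|//] := min_i (a j).
    by move=> k lt_ki; rewrite -vE; apply/nesym/v_neq; apply: ltn_trans lt_ij.
  by case: (v_neq _ _ lt_ij); rewrite !vE eq_a.
(* Surjectivity of [v]: a representative [b] of a missed class would come after every [a n]. As 1 is
   the least element, every [a n] would be supported below [rplength b], and two of these finitely
   many sequences would coincide. *)
have [idx idxK] : exists idx, cancel idx v.
  suff /choice[idx idxP] : forall x, exists n, v n = x by exists idx.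
  move=> x; have [b def_x] := cclass_surj x.
  apply: contrapT => /forallNP v_x.
  have lt_b n : revlex s (a n) b.
    have [_ _ min_n] := aP n; have [m _||//] := min_n b.
      by rewrite -def_x; apply/nesym/v_x.
    by move=> eq_b; case: (v_x n); rewrite vE -eq_b.
  have small n k : rplength b <= k -> a n k = 1.
    move=> le_k; have [j [lt_j eq_j]] := lt_b n.
    apply: etrans (rplengthP le_k); apply: eq_j.
    rewrite ltnNge; apply/negP => le_kj.
    have bj : b j = 1 := rplengthP (leq_trans le_k le_kj).
    move: lt_j s0; rewrite /enum_order bj.
    by case: (s) => //= x0 s' /[swap] -[->]; rewrite eqxx.
  have [c [g g_mono gc]] :=
    infinite_fiber (fun n => [ffun k : 'I_(rplength b) => a n k]).
  apply: (v_neq _ _ (g_mono _ _ (ltnSn 0))); rewrite !vE; congr cclass.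
  apply: rpowerP => k.
  have [le_k|lt_k] := leqP (rplength b) k; first by rewrite !small.
  have := congr1 (fun h : {ffun _} => h (Ordinal lt_k))
                 (etrans (gc 0) (esym (gc 1%N))).
  by rewrite !ffunE.
have vK : cancel v idx by move=> n; apply: v_inj; rewrite idxK.
have [g g1] : exists g : gT, g != 1.
  apply: contrapT => /forallNP triv; apply: (v_neq _ _ (ltnSn 0)); rewrite !vE.
  congr cclass; apply: rpowerP => k.
  have trivE (x : gT) : x = 1 by apply/eqP/negPn/negP/triv.
  by rewrite (trivE (a 0 k)) (trivE (a 1%N k)).
split.
  exists v; split; first by exists idx.
  move=> i j; split=> [[i' [j' [/v_inj -> /v_inj ->]]] //|lt_ij].
  by exists i, j.
move=> n t; pose r x := a (idx x).
(* The normal forms of the [n] entries of [t i], read coordinate by coordinate, form a word over the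
   alphabet of [n]-tuples. *)
pose col i k : n.-tuple gT := [tuple (r (tnth (t i) l)) k | l < n].
have colE i k l : tnth (col i k) l = r (tnth (t i) l) k by rewrite tnth_mktuple.
have [|i|i [j [neq_ij [phi [e [D [phiP col_ij]]]]]]] :=
    @thickening_wqo _ [tuple 1 | l < n] col (exponent [set: gT]).
- exact: exponent_gt0.
- exists (\max_(l < n) rplength (r (tnth (t i) l))) => k le_k.
  apply: eq_from_tnth => l; rewrite colE tnth_mktuple; apply: rplengthP.
  exact: leq_trans (leq_bigmax l) le_k.
have rE x : cclass cK (r x) = x by rewrite -vE idxK.
pose f x := cclass cK (pullback phi e (r x)).
exists i, j; split=> //; exists f; split.
- by apply: (pullback_closure alphaP phiP g1) => x; exists (r x).
- move=> _ _ [i1 [j1 [-> -> lt_ij]]]; exists (idx (f (v i1))), (idx (f (v j1))).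
  rewrite !idxK; split=> //.
  (* Both sides are normal forms of the same class. *)
  have rf x : r (f x) = pullback phi e (r x).
    apply: (normal_form_inj sP (cK := cK)); rewrite ?rE //; first exact: norm_a.
    exact: (normal_form_pullback phiP) (norm_a _).
  have lt_f : revlex s (r (f (v i1))) (r (f (v j1))).
    by rewrite !rf; apply: (revlex_pullback phiP); rewrite /r !vK; apply: a_mono.
  (* As [a] is increasing, any other comparison of the two indices contradicts the asymmetry of
     [revlex]. *)
  case: ltngtP => // [/a_mono /revlex_asym|eq_idx]; first by [].
  by move: (lt_f); rewrite /r eq_idx => /[dup] /revlex_asym.
- apply: eq_from_tnth => l; rewrite tnth_map /f -[RHS]rE; congr cclass.
  by apply: rpowerP => k; rewrite (pullbackE phiP) -!colE col_ij.
Qed.
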